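(* For every integer $n \geq 8$ with $n \equiv 0 \pmod 4$, there exists an integer relative Heffter array $\mathrm{H}_5(n;5)$.
   Context: Let $n,k,t$ be positive integers with $t$ dividing $2nk$, and let $J=\left\langle \frac{2nk+t}{t}\right\rangle$ be the subgroup of $\mathbb{Z}_{2nk+t}$ of order $t$. A Heffter array over $\mathbb{Z}_{2nk+t}$ relative to $J$, denoted by $\mathrm{H}_t(n;k)$, is an $n\times n$ partially filled array $A$ (cells may be empty) with entries in $\mathbb{Z}_{2nk+t}$ such that: (a) each row and each column contains exactly $k$ filled cells; (b) for every $x\in\mathbb{Z}_{2nk+t}\setminus J$, exactly one of $x$ and $-x$ appears in $A$ (since there are $nk$ filled cells and $nk$ pairs $\{x,-x\}$ outside $J$, each such pair is thus represented by exactly one cell and no entry lies in $J$); (c) the entries of every row and every column sum to zero in $\mathbb{Z}_{2nk+t}$. An $\mathrm{H}_t(n;k)$ is called integer if, when its entries are viewed as integers in $\pm\{1,\dots,\lfloor\frac{2nk+t}{2}\rfloor\}$ (which avoid the multiples of $\frac{2nk+t}{t}$), the entries of every row and every column sum to zero in $\mathbb{Z}$. Here $t=k=5$, so the group is $\mathbb{Z}_{10n+5}$ and $J=\langle 2n+1\rangle$ is its subgroup of order $5$. *)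

(* Defs.v *)
From mathcomp Require Import all_boot all_order all_algebra all_fingroup.

Set Implicit Arguments.
Unset Strict Implicit.
Unset Printing Implicit Defensive.

Import GRing.Theory.
Local Open Scope ring_scope.

(* Standing assumptions: 0 < n, 0 < k, 0 < t and t %| 2 * n * k. In particular
   the modulus is > 1, so that 'Z_(heffter_mod n k t) is really Z/(2nk+t). *)
Definition heffter_mod (n k t : nat) : nat := (2 * n * k + t)%N.

(* None is an empty cell. *)
Definition pfarray (n k t : nat) : Type :=
  'M[option 'Z_(heffter_mod n k t)]_n.

(* <[_]> is the subgroup generated in the additive group of 'Z_v. *)
Definition heffter_J (n k t : nat) : {set 'Z_(heffter_mod n k t)} :=
  <[ (heffter_mod n k t %/ t)%:R : 'Z_(heffter_mod n k t) ]>%g.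

Definition appears (n k t : nat) (A : pfarray n k t)
    (x : 'Z_(heffter_mod n k t)) : bool :=
  [exists i, exists j, A i j == Some x].

Record is_heffter (n k t : nat) (A : pfarray n k t) : Prop := IsHeffter {
  heffter_row_card : forall i, #|[set j | isSome (A i j)]| = k;
  heffter_col_card : forall j, #|[set i | isSome (A i j)]| = k;
  heffter_support : forall x, x \notin heffter_J n k t ->
    appears A x (+) appears A (- x);
  heffter_row_sum : forall i, \sum_j odflt 0 (A i j) = 0;
  heffter_col_sum : forall j, \sum_i odflt 0 (A i j) = 0 }.

(* The integer of least absolute value representing x mod v = heffter_mod n k t.
   The only tie, x = v / 2 with v even, lies in heffter_J (as does 0), so no
   entry of a Heffter array is affected by the choice made there. *)
Definition signed_rep (n k t : nat) (x : 'Z_(heffter_mod n k t)) : int :=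
  if (x <= (heffter_mod n k t)./2)%N then (x : nat)%:Z
  else (x : nat)%:Z - (heffter_mod n k t)%:Z.

Record is_integer_heffter (n k t : nat) (A : pfarray n k t) : Prop :=
  IsIntegerHeffter {
    integer_heffter_heffter : is_heffter A;
    integer_row_sum : forall i, \sum_j oapp (@signed_rep n k t) 0 (A i j) = 0;
    integer_col_sum : forall j, \sum_i oapp (@signed_rep n k t) 0 (A i j) = 0 }.

(* Main.v *)
Require Import Defs.
From mathcomp Require Import all_boot all_order all_algebra all_fingroup.
From mathcomp Require Import zify ring.

(* Write n = 4u + 8m with u = 0 (n = 0 mod 8) or u = 3 (n = 4 mod 8). The array is
   block diagonal: a corner of size 4u followed by m blocks of size 8, all built
   from one fixed pattern. Every entry has the form a m + c + g i, where (a, c, g) depends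
   on the cell of the pattern and i is the index of the block (g = 0 in the corner); the
   line sums vanish because the signed triples already sum to zero.

   Setting w = 2m + u = n / 4, the admissible absolute values form 20 runs of
   length w, with the multiples 8w + 1 = 2n + 1 and 16w + 2 = 4n + 2 of the generator of J
   omitted after the 8th and the 16th run. Each run consists of u values used in the corner
   and 2m values used in the blocks; the latter split into two progressions of m terms, either
   two intervals (g = 1 or -1) or the two parity classes of one interval (g = 2 or -2).
   Slopes 2 are needed because five odd slopes cannot sum to zero on a line. The
   patterns were found by a computer search. *)

Set Implicit Arguments.
Unset Strict Implicit.
Unset Printing Implicit Defensive.

Import Order.TTheory GRing.Theory Num.Theory.

(** * Least absolute residues for an odd modulus *)

Section SignedRep.
Local Open Scope ring_scope.
Variables n k t : nat.
Hypothesis v_gt1 : (1 < heffter_mod n k t)%N.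
Hypothesis v_odd : odd (heffter_mod n k t).
Local Notation v := (heffter_mod n k t).
Local Notation signed_rep := (@signed_rep n k t).

Lemma signed_repK (x : 'Z_v) : (signed_rep x)%:~R = x.
Proof.
rewrite /Defs.signed_rep; case: ifP => _; first by rewrite -pmulrn natr_Zp.
by rewrite rmorphB /= -!pmulrn natr_Zp pchar_Zp // subr0.
Qed.

(** As [v] is odd, the integers of absolute value at most [v./2] represent each residue once; a
    negative one reduces to a residue above [v./2]. *)
Lemma signed_rep_intr (e : int) : (`|e| <= v./2)%N -> signed_rep (e%:~R : 'Z_v) = e.
Proof.
have dv : v = (v./2.*2).+1 by rewrite -{1}[v]odd_double_half v_odd.
move: dv v_gt1; set h := v./2 => dv vgt1 le_e.
rewrite /Defs.signed_rep -/h.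
case: e le_e => m le_m.
  by rewrite -pmulrn val_Zp_nat // modn_small ?le_m //; lia.
have -> : (Negz m)%:~R = (v - m.+1)%:R :> 'Z_v.
  by rewrite natrB ?pchar_Zp // ?sub0r ?NegzE ?rmorphN //; lia.
rewrite val_Zp_nat // modn_small; last lia.
by rewrite ifN; lia.
Qed.

Lemma signed_rep_le (x : 'Z_v) : (`|signed_rep x| <= v./2)%N.
Proof.
have dv : v = (v./2.*2).+1 by rewrite -{1}[v]odd_double_half v_odd.
have ltx : (x < v)%N by have := ltn_ord x; rewrite [X in (_ < X)%N]Zp_cast.
move: dv ltx; rewrite /Defs.signed_rep; set h := v./2.
by move: (nat_of_ord x) => y dv ltx; case: (leqP y h) => ?; lia.
Qed.

Lemma multiple_in_heffter_J (a : nat) (x : 'Z_v) :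
  `|signed_rep x|%N = (a * (v %/ t))%N -> x \in heffter_J n k t.
Proof.
move=> dx; have aJ : (a * (v %/ t))%:R \in heffter_J n k t.
  by rewrite mulnC natrM mulr_natr -FinRing.zmodXgE mem_cycle.
rewrite -[x]signed_repK; move: dx; set N := (a * _)%N in aJ *; set e := signed_rep x.
move=> dx; have [-> | ->] : e = N%:Z \/ e = - N%:Z by lia.
  by rewrite -pmulrn.
by rewrite rmorphN /= -pmulrn -FinRing.zmodVgE groupV.
Qed.

End SignedRep.

(** * From integer arrays to integer relative Heffter arrays *)

Section IntegerArray.
Local Open Scope ring_scope.
Variable n : nat.
Variable E : 'I_n -> 'I_n -> option int.
Hypothesis row_card : forall i, #|[set j | isSome (E i j)]| = 5%N.
Hypothesis col_card : forall j, #|[set i | isSome (E i j)]| = 5%N.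
Hypothesis row_sum : forall i, \sum_j odflt 0 (E i j) = 0.
Hypothesis col_sum : forall j, \sum_i odflt 0 (E i j) = 0.
Hypothesis E_onto : forall x : nat, (0 < x <= 5 * n + 2)%N ->
  x != (2 * n + 1)%N -> x != (4 * n + 2)%N -> exists i j e, E i j = Some e /\ `|e|%N = x.

Local Notation v := (heffter_mod n 5 5).

Let v_gt1 : (1 < v)%N. Proof. rewrite /heffter_mod; lia. Qed.
Let v_odd : odd v. Proof. rewrite /heffter_mod; lia. Qed.
Let half_v : v./2 = (5 * n + 2)%N. Proof. rewrite /heffter_mod; lia. Qed.
Let v_div5 : (v %/ 5 = 2 * n + 1)%N. Proof. rewrite /heffter_mod; lia. Qed.

Let filled := [set p : 'I_n * 'I_n | isSome (E p.1 p.2)].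
Let absE (p : 'I_n * 'I_n) : nat := `|odflt (0 : int) (E p.1 p.2)|%N.
Let support := iota 1 (2 * n) ++ iota (2 * n + 2) (2 * n) ++ iota (4 * n + 3) n.

Let mem_support x : (x \in support) =
  [&& 0 < x, x <= 5 * n + 2, x != 2 * n + 1 & x != 4 * n + 2]%N.
Proof. rewrite !mem_cat !mem_iota; lia. Qed.

Let uniq_support : uniq support.
Proof.
rewrite !cat_uniq !iota_uniq !andbT /=; apply/andP; split; apply/hasPn => x;
  rewrite ?mem_cat !mem_iota; lia.
Qed.

Let card_filled : #|filled| = (5 * n)%N.
Proof.
rewrite /filled -sum1dep_card.
rewrite -(pair_big_dep xpredT (fun i j => isSome (E i j)) (fun _ _ => 1%N)) /=.
under eq_bigr => i _ do rewrite sum1dep_card row_card.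
by rewrite sum_nat_const card_ord mulnC.
Qed.

(* The 5n filled cells cover the 5n admissible absolute values, so each value
   is taken exactly once and no entry is too large. *)
Let absE_bij : uniq (map absE (enum filled)) /\ map absE (enum filled) =i support.
Proof.
have ss : {subset support <= map absE (enum filled)}.
  move=> x; rewrite mem_support => /and4P[x0 x1 x2 x3].
  have [|i [j [e [Ee ex]]]] := E_onto _ x2 x3; first by rewrite x0.
  by apply/mapP; exists (i, j); rewrite ?mem_enum ?inE /absE /= Ee.
have sz : (size (map absE (enum filled)) <= size support)%N.
  by rewrite size_map -cardE card_filled !size_cat !size_iota; lia.
have [e1 e2] := uniq_min_size uniq_support ss sz; split; last by move=> x; rewrite e2.
by rewrite (leq_size_uniq uniq_support).
Qed.

Let E_le i j e : E i j = Some e -> (0 < `|e| <= 5 * n + 2)%N.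
Proof.
move=> Ee; have : absE (i, j) \in support.
  by rewrite -absE_bij.2 map_f // mem_enum inE /= Ee.
rewrite /absE /= Ee mem_support /=; lia.
Qed.

(** Entries lie within [v./2] in absolute value, so [signed_rep] recovers them after reduction, and
    zero sums over the integers give both kinds of line sums. *)
Lemma integer_heffter_of_int_array : exists A : pfarray n 5 5, is_integer_heffter A.
Proof.
pose A : pfarray n 5 5 := \matrix_(i, j) omap (fun e => e%:~R) (E i j).
have isSomeA i j : isSome (A i j) = isSome (E i j) by rewrite mxE; case: (E i j).
have oA i j : odflt 0 (A i j) = (odflt 0 (E i j))%:~R by rewrite mxE; case: (E i j).
have sA i j : oapp (@signed_rep n 5 5) 0 (A i j) = odflt 0 (E i j).
  rewrite mxE; case Ee: (E i j) => [e|] //=.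
  by apply: signed_rep_intr => //; rewrite half_v; have := E_le Ee; lia.
exists A; split; last 2 first.
- by move=> i; under eq_bigr do rewrite sA.
- by move=> j; under eq_bigr do rewrite sA.
split.
- by move=> i; rewrite -[RHS](row_card i); apply: eq_card => j; rewrite !inE isSomeA.
- by move=> j; rewrite -[RHS](col_card j); apply: eq_card => i; rewrite !inE isSomeA.
- move=> x xJ; set s := signed_rep x.
  have s_le : (`|s| <= 5 * n + 2)%N by rewrite -half_v signed_rep_le.
  have sJ a : `|s|%N != (a * (2 * n + 1))%N.
    apply: contra xJ => /eqP sa; apply: (multiple_in_heffter_J v_gt1 v_odd (a := a)).
    by rewrite v_div5.
  (* The multiples of [2 * n + 1] up to [5 * n + 2] have factors 0, 1 and 2; [sJ] excludes them
     since [x] is outside J. *)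
  have [||| i [j [e [Ee es]]]] := E_onto (x := `|s|%N).
  + by have := sJ 0%N; lia.
  + by have := sJ 1%N; lia.
  + by have := sJ 2%N; lia.
  have Ae i' j' y : A i' j' == Some y -> E i' j' = Some (signed_rep y).
    rewrite mxE; case Ee': (E i' j') => [e'|] //= /eqP[<-].
    by rewrite signed_rep_intr // half_v; have := E_le Ee'; lia.
  (* Cells holding [x] and [- x] share an absolute value, hence coincide; then [s = - s], so
     [s = 0], which lies in J. *)
  have not_both : ~~ (appears A x && appears A (- x)).
    apply/negP => /andP[/existsP[i1 /existsP[j1 /Ae E1]]].
    move=> /existsP[i2 /existsP[j2 /Ae E2]].
    have sN : signed_rep (- x) = - s.
      rewrite -[x]signed_repK // -rmorphN signed_rep_intr //.
      by rewrite half_v; lia.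
    have [] : (i1, j1) = (i2, j2).
      apply: (dinjectiveP _ _ absE_bij.1); rewrite ?inE /absE /= ?E1 ?E2 //= sN.
      by rewrite abszN.
    move=> ? ?; subst i2 j2; move: E1 E2; rewrite sN => -> [].
    by have := sJ 0%N; rewrite -/s; lia.
  have : appears A x || appears A (- x).
    have [De | De] : e = s \/ e = - s by lia.
      apply/orP; left; apply/existsP; exists i; apply/existsP; exists j.
      by rewrite mxE Ee De /= signed_repK.
    apply/orP; right; apply/existsP; exists i; apply/existsP; exists j.
    by rewrite mxE Ee De /= rmorphN /= signed_repK.
  by move: not_both; case: appears; case: appears.
- move=> i; under eq_bigr do rewrite oA; by rewrite -rmorph_sum row_sum.
- move=> j; under eq_bigr do rewrite oA; by rewrite -rmorph_sum col_sum.
Qed.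

End IntegerArray.

(* The triple (a, c, g) stands for the value a m + c + g i in the i-th block. *)
Definition entry := (int * int * int)%type.
Definition table := seq (seq (option entry)).

Definition tab (T : table) (p q : nat) : option entry := nth None (nth [::] T p) q.

(** * Symbolic line conditions on finite tables *)

Section Tables.
Local Open Scope ring_scope.

Definition entry_val (m i : nat) (e : entry) : int :=
  e.1.1 * m%:Z + e.1.2 + e.2 * i%:Z.

Definition add_entry (e f : entry) : entry := (e.1.1 + f.1.1, e.1.2 + f.1.2, e.2 + f.2).
Definition opp_entry (e : entry) : entry := (- e.1.1, - e.1.2, - e.2).

Definition line_ok (l : seq (option entry)) : bool :=
  (count isSome l == 5%N) && (foldr add_entry (0, 0, 0) (map (odflt (0, 0, 0)) l) == (0, 0, 0)).

Definition table_ok (s : nat) (T : table) : bool :=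
  all (fun p => line_ok (mkseq (fun q => tab T p q) s) &&
                line_ok (mkseq (fun q => tab T q p) s)) (iota 0 s).

(** [entry_val m i] is additive in the triple, so a single check on triples settles all [m] and
    [i]. *)
Lemma line_sum m i s (f : nat -> option entry) : line_ok (mkseq f s) ->
  \sum_(0 <= q < s) odflt 0 (omap (entry_val m i) (f q)) = 0 :> int.
Proof.
case/andP => _ /eqP f0.
have E l : \sum_(x <- l) odflt 0 (omap (entry_val m i) x) =
   entry_val m i (foldr add_entry (0, 0, 0) (map (odflt (0, 0, 0)) l)) :> int.
  elim: l => [|x l IH]; first by rewrite big_nil /entry_val /=; ring.
  rewrite big_cons IH /=; case: x => [[[a b] c]|] /=; rewrite /entry_val /=; ring.
have := E (mkseq f s); rewrite f0 /mkseq big_map /index_iota subn0 => ->.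
by rewrite /entry_val /=; ring.
Qed.

Lemma line_count s (f : nat -> option entry) : line_ok (mkseq f s) ->
  (\sum_(0 <= q < s) isSome (f q))%N = 5%N.
Proof.
case/andP => /eqP <- _; rewrite /mkseq count_map -sumn_count sumnE !big_map.
by rewrite /index_iota subn0.
Qed.

End Tables.

(** * The block diagonal array *)

Section BlockArray.
Local Open Scope ring_scope.
Variables (m r : nat).
Implicit Types C B : nat -> nat -> option entry.

(** The guards [r <= p] and [r <= q] matter: truncated subtraction would send corner indices to
    block 0. *)
Definition block_cell C B (p q : nat) : option int :=
  if (p < r)%N && (q < r)%N then omap (entry_val m 0) (C p q)
  else if [&& r <= p, r <= q & (p - r) %/ 8 == (q - r) %/ 8]%N
  then omap (entry_val m ((p - r) %/ 8)) (B ((p - r) %% 8)%N ((q - r) %% 8)%N)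
  else None.

(** Transposition reduces column statements to row statements. *)
Lemma block_cellC C B p q :
  block_cell C B p q = block_cell (fun a b => C b a) (fun a b => B b a) q p.
Proof.
rewrite /block_cell andbC; case: ifP => // _.
rewrite andbCA [in RHS]eq_sym.
by case: (eqVneq ((p - r) %/ 8)%N) => [->|_]; rewrite ?andbF.
Qed.

(** A general [F] serves both the count of filled cells and the sum of entries. *)
Lemma block_row_sum (V : nmodType) (F : option int -> V) C B p :
  F None = 0 -> (p < r + 8 * m)%N ->
  \sum_(q < r + 8 * m) F (block_cell C B p q) =
  if (p < r)%N then \sum_(0 <= q < r) F (omap (entry_val m 0) (C p q))
  else \sum_(0 <= q < 8) F (omap (entry_val m ((p - r) %/ 8)) (B ((p - r) %% 8)%N q)).
Proof.
move=> F0 ltp; rewrite -(big_mkord xpredT (fun q => F (block_cell C B p q))).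
rewrite (@big_cat_nat _ _ _ r) ?leq_addr //=.
have [ltpr|lerp] := ltnP p r.
  rewrite [X in _ + X]big_nat_cond [X in _ + X]big1 ?addr0; last first.
    by move=> q /andP[/andP[lerq _] _]; rewrite /block_cell ltpr ltnNge lerq /= leqNgt ltpr.
  by rewrite !big_nat; apply: eq_bigr => q /= ltq; rewrite /block_cell ltpr ltq.
rewrite [X in X + _]big_nat_cond [X in X + _]big1 ?add0r; last first.
  move=> q /andP[/andP[_ ltqr] _]; rewrite /block_cell ltnNge lerp /= (leqNgt r q) ltqr.
  by rewrite F0.
set i0 := ((p - r) %/ 8)%N; have lti0 : (i0 < m)%N by rewrite /i0; lia.
(* Columns beyond the corner are grouped by eights; only the group [i0] meets row [p]. *)
rewrite -{1}[r]add0n big_addn addKn mulnC big_nat_mul.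
rewrite (bigD1_seq i0) ?iota_uniq ?mem_index_iota //=.
rewrite [X in _ + X]big1_seq ?addr0 => [|i /andP[ne _]].
  rewrite -{1}[(i0 * 8)%N]add0n big_addn; have -> : (i0.+1 * 8 - i0 * 8 = 8)%N by lia.
  rewrite !big_nat; apply: eq_bigr => q /= ltq; rewrite /block_cell.
  have -> : ((q + i0 * 8 + r - r) %/ 8 = i0)%N by lia.
  have -> : ((q + i0 * 8 + r - r) %% 8 = q)%N by lia.
  by rewrite ltnNge lerp /= leq_addl eqxx.
rewrite big_nat big1 // => q /= ltq; rewrite /block_cell ltnNge lerp /= leq_addl addnK.
rewrite -/i0; have -> : (q %/ 8 = i)%N by lia.
by rewrite eq_sym (negbTE ne) F0.
Qed.

End BlockArray.

(** * Every admissible absolute value is attained *)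

Section Coverage.
Local Open Scope ring_scope.

(* The same progression run backwards: its value at i is that of e at m - 1 - i. *)
Definition rev_entry (e : entry) : entry := (e.1.1 + e.2, e.1.2 - e.2, - e.2).

Definition occurs (s : nat) (T : table) (e : entry) : bool :=
  has (fun p => has (fun q => tab T p q == Some e) (iota 0 s)) (iota 0 s).

(** Neither a change of sign nor a reversal alters the set of absolute values taken over the [m]
    blocks. *)
Definition progression_ok (B : table) (e : entry) : bool :=
  has (occurs 8 B) [:: e; opp_entry e; rev_entry e; opp_entry (rev_entry e)].

Definition value_ok (s : nat) (C : table) (e : entry) : bool :=
  occurs s C e || occurs s C (opp_entry e).

(* In the j-th run, which starts at 2 j m + c: the interval of m values for the first
   progression, k corner values, the second progression, u - k corner values. *)
Definition split_run_ok (u : nat) (C B : table) (j c k : nat) : bool :=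
  [&& progression_ok B (j.*2%:Z, c%:Z, 1), progression_ok B (j.*2.+1%:Z, (c + k)%:Z, 1) &
      all (fun t => value_ok (4 * u) C ((j.*2.+1 + (k <= t))%:Z, (c + t)%:Z, 0)) (iota 0 u)].

(* Here the two progressions interleave and the u corner values come last. *)
Definition paired_run_ok (u : nat) (C B : table) (j c : nat) : bool :=
  [&& progression_ok B (j.*2%:Z, c%:Z, 2%:Z),
      progression_ok B (j.*2%:Z, c.+1%:Z, 2%:Z) &
      all (fun t => value_ok (4 * u) C (j.*2.+2%:Z, (c + t)%:Z, 0)) (iota 0 u)].

Definition run_ok (u : nat) (C B : table) (j : nat) : bool :=
  (* j %/ 8 counts the omitted multiples of the generator of J below the run. *)
  let c := (u * j + j %/ 8 + 1)%N in
  has (split_run_ok u C B j c) (iota 0 u.+1) || paired_run_ok u C B j c.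

Definition coverage_ok (u : nat) (C B : table) : bool := all (run_ok u C B) (iota 0 20).

Variables (m u : nat) (C B : table).
Local Notation n := (4 * u + 8 * m)%N.

Let hit (x : nat) := exists p q e,
  [/\ (p < n)%N, (q < n)%N, block_cell m (4 * u) (tab C) (tab B) p q = Some e & `|e|%N = x].

Lemma occursP s T e : occurs s T e -> exists p q, [/\ (p < s)%N, (q < s)%N & tab T p q = Some e].
Proof.
case/hasP => p; rewrite mem_iota => ltp /hasP[q]; rewrite mem_iota => ltq /eqP.
by exists p, q.
Qed.

Let hit_value a c x : value_ok (4 * u) C (a, c, 0) -> x%:Z = a * m%:Z + c -> hit x.
Proof.
move=> ok Dx; have [e Ce ex] : exists2 e, occurs (4 * u) C e & `|entry_val m 0 e|%N = x.
  by case/orP: ok => ok; [exists (a, c, 0) | exists (- a, - c, - 0)] => //;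
    rewrite /entry_val /=; lia.
have [p [q [ltp ltq Epq]]] := occursP Ce.
exists p, q, (entry_val m 0 e); split=> //; try lia.
by rewrite /block_cell ltp ltq Epq.
Qed.

Let hit_progression a c g i x : progression_ok B (a, c, g) -> (i < m)%N ->
  x%:Z = a * m%:Z + c + g * i%:Z -> hit x.
Proof.
move=> ok lti Dx.
have mi : (m - i.+1)%:Z = m%:Z - i%:Z - 1 by lia.
have [i' [e [lti' Be ex]]] : exists i' e,
    [/\ (i' < m)%N, occurs 8 B e & `|entry_val m i' e|%N = x].
  suff [i' [e [lti' Be ex]]] : exists i' e, [/\ (i' < m)%N, occurs 8 B e &
      entry_val m i' e = x%:Z \/ entry_val m i' e = - x%:Z].
    by exists i', e; split=> //; case: ex => ->; rewrite ?abszN.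
  rewrite Dx; case/hasP: ok => e; rewrite !inE => /or4P[] /eqP-> ok.
  - by exists i; eexists; split; [|exact: ok|left; rewrite /entry_val /=; ring].
  - by exists i; eexists; split; [|exact: ok|right; rewrite /entry_val /=; ring].
  - exists (m - i.+1)%N; eexists; split; [lia|exact: ok|left].
    by rewrite /entry_val /= mi; ring.
  - exists (m - i.+1)%N; eexists; split; [lia|exact: ok|right].
    by rewrite /entry_val /= mi; ring.
have [p [q [ltp ltq Epq]]] := occursP Be.
exists (4 * u + i' * 8 + p)%N, (4 * u + i' * 8 + q)%N, (entry_val m i' e).
have dE k : (k < 8)%N -> ((4 * u + i' * 8 + k - 4 * u) %/ 8 = i')%N by lia.
have mE k : (k < 8)%N -> ((4 * u + i' * 8 + k - 4 * u) %% 8 = k)%N by lia.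
split=> //; try lia.
by rewrite /block_cell !dE // !mE // Epq eqxx ifN ?ifT //; lia.
Qed.

Lemma coverage x : coverage_ok u C B -> (0 < x <= 5 * n + 2)%N ->
  x != (2 * n + 1)%N -> x != (4 * n + 2)%N -> hit x.
Proof.
move=> ok x0 x1 x2; set w := (2 * m + u)%N.
(* The rank of [x], from 0, among the admissible values; division by [w] yields its run [j] and its
   position [z] there. *)
pose y := (x - 1 - (2 * n + 1 < x) - (4 * n + 2 < x))%N.
have ny : (y < 20 * w)%N by rewrite /y /w; lia.
have w0 : (0 < w)%N by lia.
pose j := (y %/ w)%N; pose z := (y %% w)%N.
have ltj : (j < 20)%N by rewrite ltn_divLR.
have ltz : (z < w)%N by rewrite ltn_mod.
(* Since [2 * n = 8 * w], each omitted value falls between two runs, just before run 8 or run 16. *)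
have Dj : (j %/ 8 = (2 * n + 1 < x) + (4 * n + 2 < x))%N.
  have j8 : (j < 8)%N = (y < 8 * w)%N by rewrite ltn_divLR.
  have j16 : (j < 16)%N = (y < 16 * w)%N by rewrite ltn_divLR.
  rewrite /y /w in j8 j16; lia.
have Dx : x = (j * w + z + j %/ 8 + 1)%N by rewrite -divn_eq Dj /y; lia.
have := allP ok j; rewrite mem_iota => /(_ ltj); rewrite /run_ok; set c := (_ + 1)%N.
have {}Dx : x%:Z = j.*2%:Z * m%:Z + c%:Z + z%:Z by rewrite Dx /c /w; lia.
clearbody c z j; clear x0 x1 x2 y ny ltj Dj ok.
case/orP=> [/hasP[k] | /and3P[ok1 ok2 /allP ok3]].
  rewrite mem_iota => /= lek /and3P[ok1 ok2 /allP ok3].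
  have [ltzm | lemz] := ltnP z m.
    by apply: (hit_progression ok1 ltzm); rewrite Dx; lia.
  have [ltzk | lekz] := ltnP z (m + k).
    by apply: (hit_value (ok3 (z - m)%N _)); rewrite ?mem_iota ?Dx; lia.
  have [ltz2 | lez2] := ltnP z (2 * m + k).
    by apply: (hit_progression (i := (z - m - k)%N) ok2); rewrite ?Dx; lia.
  by apply: (hit_value (ok3 (z - 2 * m)%N _)); rewrite ?mem_iota ?Dx; lia.
have [ltz2 | lez2] := ltnP z (2 * m).
  have [zo | ze] := boolP (odd z).
    by apply: (hit_progression (i := z./2) ok2); rewrite ?Dx; lia.
  by apply: (hit_progression (i := z./2) ok1); rewrite ?Dx; lia.
by apply: (hit_value (ok3 (z - 2 * m)%N _)); rewrite ?mem_iota ?Dx; lia.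
Qed.

End Coverage.

(** * Reduction to finite checks independent of [m] *)

Section Assembly.
Local Open Scope ring_scope.

Lemma heffter_of_tables (u m : nat) (C B : table) :
  table_ok (4 * u) C -> table_ok 8 B -> coverage_ok u C B ->
  exists A : pfarray (4 * u + 8 * m) 5 5, is_integer_heffter A.
Proof.
move=> /allP okC /allP okB ok.
have lineC p : (p < 4 * u)%N -> line_ok (mkseq (tab C p) (4 * u)) /\
    line_ok (mkseq (fun q => tab C q p) (4 * u)).
  by move=> ltp; apply/andP/okC; rewrite mem_iota.
have lineB p : line_ok (mkseq (tab B (p %% 8)) 8) /\
    line_ok (mkseq (fun q => tab B q (p %% 8)) 8).
  by apply/andP/okB; rewrite mem_iota ltn_mod.
have isSomeE i (o : option entry) : isSome (omap (entry_val m i) o) = isSome o by case: o.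
have card_sum (f : 'I_(4 * u + 8 * m) -> option int) :
    #|[set q | isSome (f q)]| = (\sum_q isSome (f q))%N.
  by rewrite -sum1dep_card big_mkcond; apply: eq_bigr => q _; case: (f q).
pose cell := block_cell m (4 * u) (tab C) (tab B).
apply: (@integer_heffter_of_int_array _ (fun i j => cell i j)).
- move=> i; rewrite card_sum (block_row_sum (F := fun o => isSome o : nat)) //=.
  by case: ltnP => lti; under eq_bigr do rewrite isSomeE; apply: line_count;
    [exact: (lineC _ lti).1 | exact: (lineB _).1].
- move=> j; rewrite card_sum; under eq_bigr do rewrite /cell block_cellC.
  rewrite (block_row_sum (F := fun o => isSome o : nat)) //=.
  by case: ltnP => ltj; under eq_bigr do rewrite isSomeE; apply: line_count;
    [exact: (lineC _ ltj).2 | exact: (lineB _).2].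
- move=> i; rewrite (block_row_sum (F := odflt 0)) //=.
  by case: ltnP => lti; apply: line_sum; [exact: (lineC _ lti).1 | exact: (lineB _).1].
- move=> j; under eq_bigr do rewrite /cell block_cellC.
  rewrite (block_row_sum (F := odflt 0)) //=.
  by case: ltnP => ltj; apply: line_sum; [exact: (lineC _ ltj).2 | exact: (lineB _).2].
- move=> x x0 x1 x2; have [p [q [e [ltp ltq Ee ex]]]] := coverage ok x0 x1 x2.
  by exists (Ordinal ltp), (Ordinal ltq), e.
Qed.

End Assembly.

(** * The explicit patterns *)

Section Data.
Local Open Scope ring_scope.

(* The d-th entry listed in row p stands in column p + d modulo the size. *)
Definition cyclic_table (rows : seq (seq entry)) : table :=
  let s := size rows in
  mkseq (fun p => mkseq (fun q =>
    nth None (map Some (nth [::] rows p)) ((q + s - p) %% s)) s) s.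

Definition diag_table (S T : table) : table :=
  [seq l ++ nseq (size T) None | l <- S] ++ [seq nseq (size S) None ++ l | l <- T].

(** The slopes 2, -1, -1, -1, 1 are constant along the five cyclic diagonals, hence cancel on every
    row and column. *)
Definition block_mod0 : table := cyclic_table [::
  [:: (4, 2, 2); (-1, -1, -1); (-35, -3, -1); (7, 0, -1); (25, 2, 1)];
  [:: (-14, 1, 2); (27, 1, -1); (-18, -2, -1); (9, 0, -1); (-4, 0, 1)];
  [:: (12, 2, 2); (15, 0, -1); (11, 0, -1); (-22, -2, -1); (-16, 0, 1)];
  [:: (28, 3, 2); (-39, -3, -1); (38, 2, -1); (8, 0, -1); (-35, -2, 1)];
  [:: (-6, 1, 2); (-32, -3, -1); (-9, -1, -1); (17, 1, -1); (30, 2, 1)];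
  [:: (20, 3, 2); (-11, -1, -1); (25, 1, -1); (-33, -3, -1); (-1, 0, 1)];
  [:: (28, 2, 2); (-27, -2, -1); (-38, -3, -1); (18, 1, -1); (19, 2, 1)];
  [:: (20, 2, 2); (37, 2, -1); (-2, -1, -1); (-23, -2, -1); (-32, -1, 1)]]%Z.

Definition block_mod4 : table := cyclic_table [::
  [:: (4, 8, 2); (8, 10, -1); (39, 59, -1); (-33, -52, -1); (-18, -25, 1)];
  [:: (12, 19, 2); (-32, -51, -1); (36, 54, -1); (-1, -1, -1); (-15, -21, 1)];
  [:: (-22, -31, 2); (-24, -38, -1); (24, 35, -1); (23, 34, -1); (-1, 0, 1)];
  [:: (28, 45, 2); (-9, -16, -1); (19, 28, -1); (-11, -17, -1); (-27, -40, 1)];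
  [:: (4, 7, 2); (-39, -61, -1); (26, 39, -1); (37, 56, -1); (-28, -41, 1)];
  [:: (12, 20, 2); (-34, -54, -1); (-8, -13, -1); (11, 15, -1); (19, 32, 1)];
  [:: (20, 32, 2); (-30, -47, -1); (16, 23, -1); (-37, -57, -1); (31, 49, 1)];
  [:: (28, 44, 2); (-3, -5, -1); (-2, -4, -1); (-16, -26, -1); (-7, -9, 1)]]%Z.

Definition corner_fst : table := cyclic_table [::
  [:: (-6, -7, 0); (11, 16, 0); (4, 5, 0); (-40, -62, 0); (31, 48, 0)];
  [:: (-38, -57, 0); (-9, -14, 0); (38, 58, 0); (6, 9, 0); (3, 4, 0)];
  [:: (19, 31, 0); (-16, -24, 0); (18, 27, 0); (-23, -35, 0); (2, 1, 0)];
  [:: (33, 51, 0); (-25, -39, 0); (18, 28, 0); (14, 21, 0); (-40, -61, 0)];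
  [:: (-30, -45, 0); (32, 49, 0); (-19, -30, 0); (39, 60, 0); (-22, -34, 0)];
  [:: (-30, -46, 0); (9, 15, 0); (28, 42, 0); (8, 12, 0); (-15, -23, 0)]]%Z.

Definition corner_snd : table := cyclic_table [::
  [:: (-9, -13, 0); (-38, -59, 0); (24, 36, 0); (25, 38, 0); (-2, -2, 0)];
  [:: (34, 53, 0); (-12, -18, 0); (-4, -6, 0); (18, 26, 0); (-36, -55, 0)];
  [:: (14, 19, 0); (34, 52, 0); (-15, -22, 0); (-6, -8, 0); (-27, -41, 0)];
  [:: (-24, -37, 0); (35, 54, 0); (-7, -10, 0); (22, 33, 0); (-26, -40, 0)];
  [:: (-36, -56, 0); (30, 44, 0); (-8, -11, 0); (28, 43, 0); (-14, -20, 0)];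
  [:: (19, 29, 0); (22, 32, 0); (2, 3, 0); (-12, -17, 0); (-31, -47, 0)]]%Z.

(** Two 6 by 6 pieces with 60 entries in all: three corner values for each of the 20 runs. *)
Definition corner_mod4 : table := diag_table corner_fst corner_snd.

End Data.

Theorem theorem1p5 (n : nat) (hn8 : 8 <= n) (hn4 : n = 0 %[mod 4]) :
  exists A : pfarray n 5 5, is_integer_heffter A.
Proof.
have [n8 | n8] : n %% 8 = 0 \/ n %% 8 = 4 by lia.
  have -> : n = 4 * 0 + 8 * (n %/ 8) by lia.
  by apply: (@heffter_of_tables _ _ [::] block_mod0); vm_compute.
(* Here [n] is at least 12, so the subtraction is exact; [n = 12] is the corner alone. *)
have -> : n = 4 * 3 + 8 * ((n - 12) %/ 8) by lia.
by apply: (@heffter_of_tables _ _ corner_mod4 block_mod4); vm_compute.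
Qed.
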